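(* Let $\mathbf{k}$ be a field, let $I\subseteq R=\mathbf{k}[x_1,\dots,x_n]$ be a monomial ideal with full support, let $x^{\mu_I}$ be the least common multiple of its minimal monomial generators, and let $\mathcal{P}(I)\subseteq \mathcal{P}(R)$ be the polarization of $I$. Then there is an isomorphism of abstract simplicial complexes \[ K^{\mathcal{P}(\mu_I)}_{\mathcal{P}(I)} \cong EK^{\mu_I}_I , \] where $K^{\mathcal{P}(\mu_I)}_{\mathcal{P}(I)}$ is the upper Koszul simplicial complex of $\mathcal{P}(I)$ at $\mathcal{P}(\mu_I)$ and $EK^{\mu_I}_I$ is the expanded Koszul complex of $I$ at $\mu_I$.
   Context: Notation. For $\mu\in\mathbb{N}^n$, $x^\mu=x_1^{\mu_1}\cdots x_n^{\mu_n}$; monomials are identified with their exponents. $[n]=\{1,\dots,n\}$, and $x_\sigma=\prod_{i\in\sigma}x_i$ for $\sigma\subseteq[n]$. $\operatorname{supp}(x^\mu)=\{i\in[n]\mid \mu_i>0\}$. $G(I)$ is the unique minimal monomial generating set of the monomial ideal $I$; $I$ has full support if $\bigcup_{m\in G(I)}\operatorname{supp}(m)=[n]$. Koszul complex. The (upper) Koszul simplicial complex of a monomial ideal $I\subseteq \mathbf{k}[x_1,\dots,x_n]$ at $\mu\in\mathbb{N}^n$ is $K^\mu_I=\{\sigma\subseteq[n]\mid x^\mu/x_\sigma\in I\}$ (in particular $x_\sigma$ must divide $x^\mu$). The same definition is used in any polynomial ring, with the index set of its variables in place of $[n]$. Polarization. Let $\mathbf{a}=\mu_I$, i.e. $x^{\mathbf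 a}=\operatorname{lcm}(m\mid m\in G(I))$. Put $\mathcal{P}(R)=\mathbf{k}[x_{1,1},\dots,x_{1,a_1},\dots,x_{n,1},\dots,x_{n,a_n}]$. For $\mu\in\mathbb{N}^n$ with $\mu_i\le a_i$ for all $i$, the polarization $\mathcal{P}(\mu)$ is the $0/1$ exponent vector whose coordinate at $x_{i,j}$ is $1$ iff $j\le\mu_i$, so $\mathcal{P}(x^\mu)=x^{\mathcal{P}(\mu)}=\prod_{i=1}^n x_{i,1}\cdots x_{i,\mu_i}$. The polarization of $I$ is $\mathcal{P}(I)=\langle \mathcal{P}(m)\mid m\in G(I)\rangle\subseteq\mathcal{P}(R)$. Expanded Koszul complex. Let $x^{\mu}=x^{\mu_I}$ and $x^{\nu}=x^{\nu_I}$ be the lcm and the gcd of the elements of $G(I)$, and let $\mathrm{ms}(I)=x^\mu/x^\nu$ with exponents $\mathrm{ms}(I)_i=\mu_i-\nu_i$. The complex $EK^{\mu}_I$ is defined as follows. (1) For each $i\in[n]$ let $E_i=\{x_{i,1},\dots,x_{i,\mathrm{ms}(I)_i}\}$ (empty if $\mathrm{ms}(I)_i=0$); the vertex set of $EK^\mu_I$ is $\bigcup_i E_i$. (2) For each $\sigma\in K^\mu_I$ and each monomial $x^{\alpha}$ that is maximal with respect to divisibility among the divisors of $\mathrm{ms}(I)$ with $\operatorname{supp}(x^\alpha)=\sigma$ and $x^\mu/x^\alpha\in I$, add to $EK^\mu_I$ the face $\bigcup_{i\in\sigma}\{x_{i,\mathrm{ms}(I)_i-\alpha_i+1},\dots,x_{i,\mathrm{ms}(I)_i}\}$,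 together with all its subsets. Equivalently, (2$'$): for each $m\in G(I)$, with $x^\alpha=x^\mu/m$ and $\sigma=\operatorname{supp}(x^\alpha)$, add to $EK^\mu_I$ the facet $\bigcup_{i\in\sigma}\{x_{i,\mathrm{ms}(I)_i-\alpha_i+1},\dots,x_{i,\mathrm{ms}(I)_i}\}$. An isomorphism of abstract simplicial complexes is a bijection between their sets of vertices (elements $v$ such that $\{v\}$ is a face) that maps faces to faces in both directions; elements of the ground set that are not faces are ignored. *)

(* Defs.v *)
From HB Require Import structures.
From mathcomp Require Import all_boot all_algebra finmap.
From mathcomp Require Import boolp classical_sets.
From mathcomp Require Import monalg.

Set Implicit Arguments.
Unset Strict Implicit.
Unset Printing Implicit Defensive.

Import GRing.Theory.

(* In this file "[set x | P]", "\subset", "@:" and "\in" on [{set T}] are the  *)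
(* finset ones; the possibly infinite sets [set T] of classical_sets are written *)
(* with the delimiter %classic.                                                 *)
Local Open Scope ring_scope.

(* Monomials are identified with their exponent vectors: both are {cmonom V}.   *)

Notation polyring k V := {malg k[{cmonom V}]}.

Section Monomials.
Context {V : finType}.
Implicit Types (m : {cmonom V}) (s : {set V}) (S : set {cmonom V}).

Definition mkmon (f : V -> nat) : {cmonom V} :=
  [cmonom f v | v in [fset v | v in V]%fset]%M.

Lemma mkmonE f v : mkmon f v = f v.
Proof. by rewrite cmE fsfun_fun !inE. Qed.

Definition mdvd m1 m2 : bool := [forall v, (m1 v <= m2 v)%N].

Definition supp m : {set V} := [set v | (0 < m v)%N].

Definition xset s : {cmonom V} := mkmon (fun v => v \in s).

Definition is_lcm S m : Prop :=
  (forall g, S g -> mdvd g m) /\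
  (forall m', (forall g, S g -> mdvd g m') -> mdvd m m').

Definition is_gcd S m : Prop :=
  (forall g, S g -> mdvd m g) /\
  (forall m', (forall g, S g -> mdvd m' g) -> mdvd m' m).

(* Over the generators of a monomial ideal, which are finitely many, the        *)
(* default value 1 is reached only by the gcd of the empty set.                 *)
Definition mlcm S : {cmonom V} := xget (onecm V) [set m | is_lcm S m]%classic.
Definition mgcd S : {cmonom V} := xget (onecm V) [set m | is_gcd S m]%classic.

End Monomials.

Section Ideals.
Context {A : comNzRingType}.

(* Unlike [idealr_closed], the unit ideal is allowed. *)
Definition is_ideal (J : set A) : Prop :=
  [/\ J 0, forall p q, J p -> J q -> J (p + q) & forall p q, J q -> J (p * q)].

Definition ideal_gen (S : set A) : set A := smallest is_ideal S.

End Ideals.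

Section MonomialIdeals.
Context {k : fieldType} {V : finType}.
Implicit Types (m : {cmonom V}) (M : set {cmonom V}) (I : set (polyring k V)).

Definition xmon m : polyring k V := << m >>.

Definition monideal M : set (polyring k V) := ideal_gen (xmon @` M)%classic.

Definition monomial_ideal I : Prop := exists M, I = monideal M.

Definition minimal_generating_set I M : Prop :=
  I = monideal M /\
  forall M', (M' `<=` M)%classic -> I = monideal M' -> M' = M.

(* G(I): such a set exists and is unique when [I] is a monomial ideal. *)
Definition mingens I : set {cmonom V} :=
  xget classical_sets.set0 [set M | minimal_generating_set I M]%classic.

Definition full_support I : Prop :=
  forall v, exists2 m, mingens I m & v \in supp m.

Definition lcm_gens I : {cmonom V} := mlcm (mingens I).
Definition gcd_gens I : {cmonom V} := mgcd (mingens I).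

Definition koszul I m : {set {set V}} :=
  [set s | mdvd (xset s) m && `[< I (xmon (divcm m (xset s))) >]].

End MonomialIdeals.

(* [existT _ i j], with [j < a i], stands for the variable x_{i,j+1}: the second *)
(* index starts from 0.                                                         *)
Definition expvar (V : finType) (a : {cmonom V}) : finType :=
  {i : V & 'I_(a i)}.

Section Polarization.
Context {k : fieldType} {V : finType}.

Definition polar (a m : {cmonom V}) : {cmonom expvar a} :=
  mkmon (fun e : expvar a => (tagged e < m (tag e))%N).

Definition polarization (I : set (polyring k V)) :
    set (polyring k (expvar (lcm_gens I))) :=
  monideal (polar (lcm_gens I) @` mingens I)%classic.

End Polarization.
Arguments polarization {k V} I _.

Section ExpandedKoszul.
Context {k : fieldType} {V : finType} (I : set (polyring k V)).
Implicit Types (s : {set V}) (a b : {cmonom V}).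

Definition ms : {cmonom V} := divcm (lcm_gens I) (gcd_gens I).

Definition ek_admissible s a : Prop :=
  [/\ mdvd a ms, supp a = s & I (xmon (divcm (lcm_gens I) a))].

Definition ek_maximal s a : Prop :=
  ek_admissible s a /\ forall b, ek_admissible s b -> mdvd a b -> b = a.

(* With indices starting from 0, x_{i,ms_i-a_i+1}, ..., x_{i,ms_i} are the      *)
(* pairs (i, j) such that ms_i - a_i <= j < ms_i.                               *)
Definition ek_face s a : {set expvar ms} :=
  [set e : expvar ms | (tag e \in s) && (ms (tag e) - a (tag e) <= tagged e)%N].

Definition expanded_koszul : {set {set expvar ms}} :=
  [set t : {set expvar ms} |
    `[< exists s a, [/\ s \in koszul I (lcm_gens I), ek_maximal s a
                      & t \subset ek_face s a] >]].

End ExpandedKoszul.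
Arguments expanded_koszul {k V} I.

(* A simplicial complex is given by its set of faces, and its vertices are the  *)
(* points of the ground type that are faces.  With [s] empty the condition also *)
(* distinguishes the complex without faces from the one whose only face is the  *)
(* empty set.                                                                   *)
Definition vertex (T : finType) (D : {set {set T}}) : finType :=
  {v : T | [set v] \in D}.

Definition complex_iso (T1 T2 : finType)
    (D1 : {set {set T1}}) (D2 : {set {set T2}}) : Prop :=
  exists2 f : vertex D1 -> vertex D2, bijective f &
    forall s : {set vertex D1},
      ([set val v | v in s] \in D1) = ([set val (f v) | v in s] \in D2).

(* Main.v *)
Require Import Defs.
From HB Require Import structures.
From mathcomp Require Import all_boot all_algebra finmap.
From mathcomp Require Import boolp classical_sets.
From mathcomp Require Import monalg.
From mathcomp Require Import zify.

(** Write [a] for the lcm and [c] for the gcd of the minimal generators [G] of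
    [I].  A set [s] of variables of the polarized ring is a face of the Koszul
    complex of the polarization iff the product of the variables outside [s] is
    divisible by the polarization of some [g] in [G], that is, iff there is a
    [g] with [g_i <= j] for every x_{i,j+1} in [s] ([koszul_polarP]).  On the other
    side, a face of the expanded Koszul complex is a set of pairs (i, j) with
    [g_i - c_i <= j] for some common [g] ([expanded_koszulP]), because every
    admissible exponent is bounded by some [a - g] and every [a - g] is bounded by
    a maximal admissible exponent.  Shifting the second index by [c_i] thus turns
    one condition into the other.  The shift is injective, and it reaches every
    vertex of the first complex, since a vertex (i, j) there has
    [j >= g_i >= c_i] for some [g].

    The argument rests on [c <= g <= a] for [g] in [G], so the lcm has to exist and
    [G] has to be bounded.  This is where Dickson's lemma enters: it shows that
    [G] exists and is finite ([mingens_finite]). *)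

Set Implicit Arguments.
Unset Strict Implicit.
Unset Printing Implicit Defensive.

Import GRing.Theory.

(** * Divisibility of monomials *)

Section Divisibility.
Context {V : finType}.
Implicit Types (m : {cmonom V}) (S : set {cmonom V}).

Lemma mdvdP m1 m2 : reflect (forall v, m1 v <= m2 v) (mdvd m1 m2).
Proof. exact: forallP. Qed.

Lemma mdvd_refl m : mdvd m m.
Proof. exact/mdvdP. Qed.

Lemma mdvd_trans m2 m1 m3 : mdvd m1 m2 -> mdvd m2 m3 -> mdvd m1 m3.
Proof.
by move=> /mdvdP h /mdvdP h'; apply/mdvdP => v; apply: leq_trans (h' v).
Qed.

Lemma is_lcm_exists S b :
  (forall g, S g -> mdvd g b) -> exists m, is_lcm S m.
Proof.
move=> Sb; exists (mkmon (fun v =>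
  \max_(i < (b v).+1 | `[< exists2 g, S g & g v = i >]) i)); split.
  move=> g Sg; apply/mdvdP => v; rewrite mkmonE.
  have gb : g v < (b v).+1 by rewrite ltnS; apply/mdvdP; apply: Sb.
  by apply: (@leq_bigmax_cond _ _ (fun i => nat_of_ord i) (Ordinal gb));
    apply/asboolP; exists g.
move=> m' Sm'; apply/mdvdP => v; rewrite mkmonE.
apply/bigmax_leqP => i /asboolP[g Sg <-]; apply/mdvdP; exact: Sm'.
Qed.

(** The gcd of [S] is the lcm of the common divisors of [S]. *)
Lemma is_gcd_exists S g0 : S g0 -> exists m, is_gcd S m.
Proof.
move=> Sg0.
have [|m [ub least]] :=
    @is_lcm_exists (fun d => forall g, S g -> mdvd d g) g0.
  by move=> d; apply.
by exists m; split=> // g Sg; apply: least => d; apply.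
Qed.

Lemma mdvd_mlcm S b g :
  (forall g', S g' -> mdvd g' b) -> S g -> mdvd g (mlcm S).
Proof. by move=> /is_lcm_exists /(xgetPex (onecm V)) [+ _]; apply. Qed.

Lemma mgcd_mdvd S g : S g -> mdvd (mgcd S) g.
Proof.
by move=> Sg; have [+ _] := xgetPex (onecm V) (is_gcd_exists Sg); apply.
Qed.

Lemma mdvd_sum_eq m1 m2 :
  mdvd m1 m2 -> \sum_v m2 v <= \sum_v m1 v -> m2 = m1.
Proof.
move=> /mdvdP m12 le21; apply/eqP/cmP => v; apply/eqP.
have := leqif_sum (fun v (_ : true) => leqif_eq (m12 v)) => -[le12 eqE].
move: eqE; rewrite eqn_leq le12 le21 => /esym/forallP/(_ v) /=.
by rewrite eq_sym.
Qed.

(** Among the multiples of [m] in [S], one of largest degree is maximal. *)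
Lemma maximal_exists S b m :
  (forall g, S g -> mdvd g b) -> S m ->
  exists m', [/\ S m', mdvd m m' & forall g, S g -> mdvd m' g -> g = m'].
Proof.
move=> Sb Sm.
pose P d := `[< exists g, [/\ S g, mdvd m g & \sum_v g v = d] >].
have exP : exists d, P d.
  by exists (\sum_v m v); apply/asboolP; exists m; split=> //; apply: mdvd_refl.
have ubP d : P d -> d <= \sum_v b v.
  by move=> /asboolP[g [/Sb/mdvdP gb _ <-]]; apply: leq_sum.
case: (ex_maxnP exP ubP) => d /asboolP[m' [Sm' mm' <-]] maxd.
exists m'; split=> // g Sg m'g; apply: (mdvd_sum_eq m'g).
by apply: maxd; apply/asboolP; exists g; split=> //; apply: mdvd_trans m'g.
Qed.

End Divisibility.

(** * Dickson's lemma *)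

(** The induction is on the set of coordinates that are compared.  A basis [F]
    for the coordinates other than [v] also serves, for all coordinates, those
    elements of [S] whose [v]-coordinate is at least the largest one in [F];
    the other elements fall into finitely many classes on which the
    [v]-coordinate is constant, and each class has a basis by induction. *)
Lemma dickson_coords (V : finType) (vs : seq V) (S : set {cmonom V}) :
  exists2 F : seq {cmonom V}, (forall f, f \in F -> S f) &
    forall s, S s -> exists2 f, f \in F & forall v, v \in vs -> f v <= s v.
Proof.
elim: vs S => [|v vs IH] S.
  have [[s Ss]|noS] := pselect (exists s, S s).
    exists [:: s] => [f|t _]; first by rewrite inE => /eqP->.
    by exists s; rewrite ?inE.
  by exists [::] => // s Ss; case: noS; exists s.
have [F FS Fle] := IH S.
have /choice[Fj FjP] : forall j, exists Fj : seq {cmonom V},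
    (forall f, f \in Fj -> S f /\ f v = j) /\
    forall s, S s /\ s v = j ->
      exists2 f, f \in Fj & forall v', v' \in vs -> f v' <= s v'.
  move=> j; have [Fj FjS Fjle] := IH [set s | S s /\ s v = j]%classic.
  by exists Fj.
pose N := \max_(f <- F) f v.
exists (F ++ flatten [seq Fj j | j <- iota 0 N]).
  move=> f; rewrite mem_cat => /orP[/FS//|/flatten_mapP[j _ fFj]].
  by have [/(_ _ fFj)[]] := FjP j.
move=> s Ss; have [Ns|sN] := leqP N (s v).
  have [f fF fs] := Fle s Ss; exists f; first by rewrite mem_cat fF.
  move=> v'; rewrite inE => /predU1P[->|/fs//].
  apply: leq_trans Ns.
  by apply: (leq_bigmax_seq (F := fun f : {cmonom V} => f v)).
have [FjS /(_ s (conj Ss erefl))[f fF fs]] := FjP (s v); exists f.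
  rewrite mem_cat; apply/orP; right; apply/flatten_mapP; exists (s v) => //.
  by rewrite mem_iota.
by move=> v'; rewrite inE => /predU1P[->|/fs//]; rewrite (FjS f fF).2.
Qed.

Lemma dickson (V : finType) (S : set {cmonom V}) :
  exists2 F : seq {cmonom V}, (forall f, f \in F -> S f) &
    forall s, S s -> exists2 f, f \in F & mdvd f s.
Proof.
have [F FS Fle] := dickson_coords (enum V) S.
exists F => // s /Fle[f fF fs]; exists f => //.
by apply/mdvdP => v; apply: fs; rewrite mem_enum.
Qed.

(** * Monomial ideals and their minimal generators *)

Lemma ideal_gen_is_ideal (A : comNzRingType) (S : set A) :
  is_ideal (ideal_gen S).
Proof.
split=> [J [[J0 _ _] _] //|p q Ip Iq J SJ|p q Iq J SJ].
  by have [[_ JD _] _] := SJ; apply: JD; [apply: Ip|apply: Iq].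
by have [[_ _ JM] _] := SJ; apply: JM; apply: Iq.
Qed.

Section MonomialIdeals.
Context {k : fieldType} {V : finType}.
Implicit Types (m g : {cmonom V}) (M : set {cmonom V}).
Implicit Types (I : set (polyring k V)).

(** The polynomials all of whose monomials are divisible by an element of [M]
    form an ideal that contains the generators. *)
Lemma monidealP M m :
  monideal (k := k) M (xmon m) <-> exists2 g, M g & mdvd g m.
Proof.
pose J (p : polyring k V) :=
  forall m, m \in msupp p -> exists2 g, M g & mdvd g m.
split=> [Im|[g Mg gm]].
  suff Jm : J (xmon m) by apply: Jm; rewrite msuppU1 in_fset1.
  apply: Im; split; last first.
    by move=> _ [g Mg <-] m'; rewrite msuppU1 in_fset1 => /eqP->;
      exists g => //; apply: mdvd_refl.
  split=> [m'|p q Jp Jq m'|p q Jq m']; first by rewrite msupp0.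
    by move/(fsubsetP (msuppD_le p q)); rewrite in_fsetU => /orP[/Jp|/Jq].
  move=> /msuppM_le[m1 [m2 [_ /Jq[g Mg gm2] ->]]]; exists g => //.
  apply: (mdvd_trans gm2); apply/mdvdP => v; rewrite cmM; exact: leq_addl.
have -> : xmon m = (xmon (divcm m g) * xmon g)%R :> polyring k V.
  rewrite /xmon [RHS](malgMEw msuppU_le msuppU_le) !big_seq_fset1.
  rewrite !mcoeffUU mulr1.
  suff <- : m = mmul (divcm m g) g by [].
  by apply/eqP/cmP => v; rewrite cmM divcmE subnK //; apply/mdvdP.
have [_ _ +] := ideal_gen_is_ideal (@xmon k V @` M)%classic; apply.
by apply: sub_gen_smallest; exists g.
Qed.

Lemma monideal_sub M M' :
  (forall m, M m -> exists2 g, M' g & mdvd g m) ->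
  (monideal (k := k) M `<=` monideal M')%classic.
Proof.
move=> MM'; apply: smallest_sub; first exact: ideal_gen_is_ideal.
by move=> _ [m /MM' gm <-]; apply/monidealP.
Qed.

(** By Dickson's lemma [I] has finite monomial generating sets; one with the
    fewest elements is minimal.  Conversely a minimal generating set equals the
    finite subset that Dickson's lemma extracts from it. *)
Lemma mingens_finite I : monomial_ideal I ->
  I = monideal (mingens I) /\
  exists F : seq {cmonom V}, mingens I = [set m | m \in F]%classic.
Proof.
move=> [M0 IM0].
have fin M : exists2 F : seq {cmonom V}, (forall f, f \in F -> M f) &
    monideal (k := k) M = monideal [set m | m \in F]%classic.
  have [F FM Fle] := dickson M; exists F => //.
  apply/seteqP; split; apply: monideal_sub => m.
    by move=> /Fle[f fF fm]; exists f.
  by move=> /FM Mm; exists m => //; apply: mdvd_refl.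
have [IG Gmin] : minimal_generating_set I (mingens I).
  apply: xgetPex.
  pose P n := `[< exists F : seq {cmonom V},
    I = monideal [set m | m \in F]%classic /\ size F = n >].
  have exP : exists n, P n.
    have [F _ MF] := fin M0; exists (size F); apply/asboolP.
    by exists F; rewrite IM0.
  case: (ex_minnP exP) => n /asboolP[F [IF <-]] minF.
  exists [set m | m \in F]%classic; split=> // M' M'F IM'.
  pose F' := [seq m <- F | `[< M' m >]].
  have M'E : M' = [set m | m \in F']%classic.
    apply/seteqP; split=> m /=; rewrite mem_filter; last by case/andP=> /asboolP.
    by move=> M'm; rewrite (M'F m M'm) andbT; apply/asboolP.
  have : size F <= size F' by apply: minF; apply/asboolP; exists F'; rewrite -M'E.
  rewrite size_filter => cF; rewrite M'E /F'.
  suff /all_filterP -> : all (fun m => `[< M' m >]) F by [].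
  by rewrite all_count eqn_leq count_size.
split=> //; have [F FG GF] := fin (mingens I); exists F.
by apply/esym/Gmin => //; rewrite -GF.
Qed.

Lemma mingens_mdvd_lcm I g :
  monomial_ideal I -> mingens I g -> mdvd g (lcm_gens I).
Proof.
move=> /mingens_finite[_ [F GF]].
apply: (@mdvd_mlcm _ _ (mkmon (fun v => \max_(f <- F) f v))) => g'.
rewrite GF => g'F; apply/mdvdP => v; rewrite mkmonE.
exact: (leq_bigmax_seq (F := fun f : {cmonom V} => f v)).
Qed.

Lemma gcd_mdvd_mingens I g : mingens I g -> mdvd (gcd_gens I) g.
Proof. exact: mgcd_mdvd. Qed.

End MonomialIdeals.

(** * The faces of the two complexes *)

Section PolarizedKoszul.
Context {k : fieldType} {V : finType}.

(** The vector [polar a a] is constantly 1, so the complement of [s] is what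
    remains of it, and only the coordinates in [s] constrain [g]. *)
Lemma koszul_polarP (a : {cmonom V}) (G : set {cmonom V})
    (s : {set expvar a}) :
  reflect (exists2 g, G g & forall e, e \in s -> g (tag e) <= tagged e)
    (s \in koszul (monideal (k := k) (polar a @` G)%classic) (polar a a)).
Proof.
have polar_aE e : polar a a e = 1 by rewrite mkmonE ltn_ord.
have xsetE e : xset s e = (e \in s) by rewrite mkmonE.
rewrite inE; have -> /= : mdvd (xset s) (polar a a).
  by apply/mdvdP => e; rewrite xsetE polar_aE leq_b1.
apply: (iffP (asboolP _)) => [/monidealP[_ [g Gg <-] /mdvdP gs]|[g Gg gs]].
  exists g => // e es; have := gs e.
  by rewrite divcmE polar_aE xsetE es mkmonE; case: ltnP.
apply/monidealP; exists (polar a g); first by exists g.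
apply/mdvdP => e; rewrite divcmE polar_aE xsetE mkmonE.
by case: (boolP (e \in s)) => [/gs|_]; case: ltnP.
Qed.

End PolarizedKoszul.

Lemma msE (k : fieldType) (V : finType) (I : set (polyring k V)) v :
  ms I v = lcm_gens I v - gcd_gens I v.
Proof. exact: divcmE. Qed.

Section ExpandedKoszul.
Context {k : fieldType} {V : finType} (I : set (polyring k V)).

(** The exponents [a - g] need not be maximal, but each lies below a maximal one
    with the same support, whose face contains theirs.  Conversely an admissible
    [b] has [a - b] in [I], so [b <= a - g] for some [g], and the face of [b]
    lies in the set that [g] describes. *)
Lemma expanded_koszulP (t : {set expvar (ms I)}) :
  monomial_ideal I ->
  reflect (exists2 g, mingens I g &
             forall e, e \in t -> g (tag e) <= tagged e + gcd_gens I (tag e))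
    (t \in expanded_koszul I).
Proof.
move=> Imon; have [IG _] := mingens_finite Imon.
have memI m : I (xmon m) <-> exists2 g, mingens I g & mdvd g m.
  by rewrite {1}IG; apply: monidealP.
rewrite inE; apply: (iffP (asboolP _)) => [[s [b]]|[g Gg gt]].
  move=> [_ [[/mdvdP bms _ /memI[g Gg /mdvdP gab]] _] /fintype.subsetP tb].
  exists g => // e /tb; rewrite inE => /andP[_].
  by move: (bms (tag e)) (gab (tag e)) (msE I (tag e)); rewrite divcmE; lia.
have /mdvdP ga := mingens_mdvd_lcm Imon Gg.
have /mdvdP cg := gcd_mdvd_mingens Gg.
pose b := divcm (lcm_gens I) g.
have bE v : b v = lcm_gens I v - g v by rewrite divcmE.
pose s := supp b.
have sE v : (v \in s) = (0 < lcm_gens I v - g v) by rewrite inE bE.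
have b_adm : ek_admissible I s b.
  split=> //; first by apply/mdvdP => v; rewrite msE bE leq_sub2l.
  apply/memI; exists g => //; apply/mdvdP => v; rewrite divcmE bE.
  by have := ga v; lia.
have [|b' [b'_adm /mdvdP bb' b'_max]] :=
    maximal_exists (S := ek_admissible I s) (b := ms I) _ b_adm.
  by move=> ? [].
exists s, b'; split=> //; last first.
  apply/fintype.subsetP => e /gt; rewrite inE sE.
  have := ltn_ord (tagged e); move: (bb' (tag e)) (ga (tag e)) (msE I (tag e)).
  by rewrite bE; lia.
rewrite inE; apply/andP; split.
  by apply/mdvdP => v; rewrite mkmonE sE; lia.
apply/asboolP/memI; exists g => //; apply/mdvdP => v.
by rewrite divcmE mkmonE sE; have := ga v; lia.
Qed.

End ExpandedKoszul.

(** * The isomorphism *)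

(** The isomorphism goes against [h]: the inverse of [h] is only defined on the
    vertices of [D1], while [h] itself is total. *)
Lemma complex_iso_preim (T1 T2 : finType) (D1 : {set {set T1}})
    (D2 : {set {set T2}}) (h : T2 -> T1) :
  injective h ->
  (forall v, [set v] \in D1 -> exists w, h w = v) ->
  (forall t, (t \in D2) = (h @: t \in D1)) ->
  complex_iso D1 D2.
Proof.
move=> h_inj h_surj D2E.
have lift (v : vertex D1) : exists w, h w == val v.
  by have [w <-] := h_surj _ (valP v); exists w.
have liftE v : h (xchoose (lift v)) = val v.
  by apply/eqP; apply: (xchooseP (lift v)).
have lift_vertex v : [set xchoose (lift v)] \in D2.
  by rewrite D2E imset_set1 liftE; exact: (valP v).
have h_vertex (w : vertex D2) : [set h (val w)] \in D1.
  by rewrite -imset_set1 -D2E; exact: (valP w).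
pose f v : vertex D2 := exist _ (xchoose (lift v)) (lift_vertex v).
pose f' w : vertex D1 := exist _ (h (val w)) (h_vertex w).
exists f.
  exists f' => [v|w]; apply: val_inj => /=; first exact: liftE.
  by apply: h_inj; exact: (liftE (f' w)).
move=> s; rewrite D2E -imset_comp; congr (_ \in D1).
by apply: eq_imset => v; rewrite -[LHS]liftE.
Qed.

Lemma expvar_inj (V : finType) (a : {cmonom V}) (e e' : expvar a) :
  tag e = tag e' -> tagged e = tagged e' :> nat -> e = e'.
Proof.
by case: e e' => v i [v' i'] /= eqv; case: _ / eqv i' => i' /val_inj ->.
Qed.

Section Shift.
Context {k : fieldType} {V : finType} (I : set (polyring k V)).

Lemma shift_subproof (e : expvar (ms I)) :
  tagged e + gcd_gens I (tag e) < lcm_gens I (tag e).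
Proof. by move: (ltn_ord (tagged e)) (msE I (tag e)); lia. Qed.

Definition shift (e : expvar (ms I)) : expvar (lcm_gens I) :=
  existT _ (tag e) (Ordinal (shift_subproof e)).

Lemma shift_inj : injective shift.
Proof.
move=> e e' ee'; have tag_eq : tag e = tag e' := congr1 tag ee'.
have /= := congr1 (fun e : expvar (lcm_gens I) => nat_of_ord (tagged e)) ee'.
have -> : gcd_gens I (tag e) = gcd_gens I (tag e') by rewrite tag_eq.
by move=> /addIn; apply: expvar_inj.
Qed.

Lemma shift_surj (e : expvar (lcm_gens I)) :
  gcd_gens I (tag e) <= tagged e -> exists e', shift e' = e.
Proof.
move=> ce.
have lt_ms : tagged e - gcd_gens I (tag e) < ms I (tag e).
  by rewrite msE; have := ltn_ord (tagged e); lia.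
exists (existT _ (tag e) (Ordinal lt_ms)).
by apply: expvar_inj => //=; rewrite subnK.
Qed.

End Shift.

Theorem proposition4p3 (k : fieldType) (n : nat) (I : set (polyring k 'I_n)) :
  monomial_ideal I ->
  full_support I ->
  complex_iso
    (koszul (polarization I) (polar (lcm_gens I) (lcm_gens I)))
    (expanded_koszul I).
Proof.
move=> Imon _; apply: (complex_iso_preim (@shift_inj _ _ I)) => [v|t].
  move=> /koszul_polarP[g Gg /(_ v (set11 v)) gv]; apply: shift_surj.
  by apply: leq_trans gv; apply/mdvdP; apply: gcd_mdvd_mingens.
apply/(expanded_koszulP _ Imon)/koszul_polarP => -[g Gg gt]; exists g => // e.
  by move=> /imsetP[e' /gt ge' ->].
by move=> et; apply: (gt (shift e)); apply: imset_f.
Qed.
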